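(* Let $\ell\ge0$ and let the sequence $X_k$, $k\ge1$, be defined by the updates $X_{k+1}\in\operatorname*{arg\,min}_XF_\ell(X;X_k)$. The sequence $f(X_k)$ is decreasing (i.e., $f(X_k)\ge f(X_{k+1})$ for all $k$); suppose it converges to $\hat f$. Then the rate of convergence of $X_k$ to this first order stationary point is given by $$ \min_{1\le k\le\mathcal K}\Delta_\ell(X_k;X_{k+1})\le\frac1{\mathcal K}\left(f(X_1)-\hat f\right) $$ for every integer $\mathcal K\ge 1$.
   Context: $\Omega\subset\{1,\dots,m\}\times\{1,\dots,n\}$ is the set of observed indices, and $Y$ is an $m\times n$ data matrix observed on $\Omega$. For a matrix $A$, $\mathcal P_\Omega(A)$ has $(i,j)$ entry $a_{ij}$ if $(i,j)\in\Omega$ and $0$ otherwise, and $\mathcal P_\Omega^\perp(A)=A-\mathcal P_\Omega(A)$. $\|\cdot\|_F$ is the Frobenius norm and $\sigma_1(X)\ge\sigma_2(X)\ge\cdots$ are the singular values of $X\in\mathbb{R}^{m\times n}$. The parameters $(\lambda,\gamma)$ index the penalty. $\sigma\mapsto P(\sigma;\lambda,\gamma)$ is a concave penalty function on $[0,\infty)$, taking the value $\infty$ whenever $\sigma<0$, and assumed to be differentiable on $(0,\infty)$ with derivative $P'(\cdot;\lambda,\gamma)$; set $$\phi_P := \inf_{\alpha,\alpha'>0} \frac{P'(\alpha;\lambda,\gamma)-P'(\alpha';\lambda,\gamma)}{\alpha-\alpha'}.$$ Define $$ f(X)=\tfrac12\|\mathcal P_\Omega(X-Y)\|_F^2+\sum_{i=1}^{\min\{m,n\}}P(\sigma_i(X);\lambda,\gamma),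 $$ $$ F_\ell(X;X_k)=\tfrac12\|\mathcal P_\Omega(X-Y)\|_F^2+\tfrac12\|\mathcal P_\Omega^\perp(X-X_k)\|_F^2+\tfrac{\ell}{2}\|X-X_k\|_F^2+\sum_{i=1}^{\min\{m,n\}}P(\sigma_i(X);\lambda,\gamma), $$ $$ \nu(\ell)=1+\phi_P+\ell,\qquad \nu^\dagger(\ell)=\max\{\nu(\ell),0\}, $$ $$ \Delta_\ell(X_k;X_{k+1})=\tfrac{\nu^\dagger(\ell)+\ell}{2}\|X_{k+1}-X_k\|_F^2+\tfrac12\|\mathcal P_\Omega^\perp(X_{k+1}-X_k)\|_F^2. $$ Terminology: $X_a$ is said to be a first order stationary point for the problem of minimizing $f$ if $\Delta_\ell(X_a;X_{a+1})=0$, where $X_{a+1}$ is the update of $X_a$; it is an $\epsilon$-accurate first order stationary point if $\Delta_\ell(X_a;X_{a+1})\le\epsilon$.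
   Formalization: The penalty P is additionally assumed nondecreasing on [0,∞) and right-continuous at 0; the claim fails without either (e.g. P(σ) = −cσ, or P = λ·1[σ>0], with m = n = 1, ℓ = 0 and all entries observed). *)

(* Defs.v *)
From HB Require Import structures.
From mathcomp Require Import all_boot all_order all_algebra.
From mathcomp Require Import polyrcf.
From mathcomp Require Import all_classical all_reals all_analysis.

Set Implicit Arguments.
Unset Strict Implicit.
Unset Printing Implicit Defensive.

Import Order.TTheory GRing.Theory Num.Theory.
Import numFieldNormedType.Exports.

Local Open Scope classical_set_scope.
Local Open Scope ring_scope.

(* Real eigenvalues repeated according to algebraic multiplicity, in
   nonincreasing order; [rootsR] lists each real root only once. *)
Definition eigenvalues (R : realType) (n : nat) (A : 'M[R]_n) : seq R :=
  sort (fun x y => y <= x)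
    (flatten [seq nseq (mup x (char_poly A)) x | x <- rootsR (char_poly A)]).

(* Singular values are numbered from 0, so sigma_(i+1)(X) is
   [singular_value X i]. If m < n, the i < minn m n skip only zeros. *)
Definition singular_value (R : realType) (m n : nat) (X : 'M[R]_(m, n))
    (i : nat) : R :=
  Num.sqrt (eigenvalues (X^T *m X))`_i.

Definition frobenius (R : realType) (m n : nat) (X : 'M[R]_(m, n)) : R :=
  Num.sqrt (\sum_(i < m) \sum_(j < n) X i j ^+ 2).

Definition proj_obs (R : realType) (m n : nat) (Omega : {set 'I_m * 'I_n})
    (A : 'M[R]_(m, n)) : 'M[R]_(m, n) :=
  \matrix_(i < m, j < n) (if (i, j) \in Omega then A i j else 0).

Definition proj_unobs (R : realType) (m n : nat) (Omega : {set 'I_m * 'I_n})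
    (A : 'M[R]_(m, n)) : 'M[R]_(m, n) :=
  A - proj_obs Omega A.

(* Here and below P is the function P(.; lambda, gamma) for fixed parameters.
   [penalty_nondecreasing] and [penalty_right_continuous0] spell out what
   "penalty function" is taken to mean. For a concave function, the former says
   exactly that P is bounded below on [0, +oo[; every nonnegative penalty
   satisfies it. The latter is the only part of continuity on [0, +oo[ that
   differentiability on ]0, +oo[ leaves open. *)
Record penalty (R : realType) (P : R -> \bar R) : Prop := Penalty {
  penalty_neg : forall s : R, s < 0 -> P s = +oo%E;
  penalty_fin_num : forall s : R, 0 <= s -> P s \is a fin_num;
  penalty_concave :
    convex_function [set s : R^o | 0 <= s] (fun s : R => - fine (P s));
  penalty_nondecreasing : forall s t : R, 0 <= s -> s <= t -> (P s <= P t)%E;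
  penalty_right_continuous0 : P s @[s --> 0^'+] --> P 0;
  penalty_derivable : forall s : R, 0 < s -> derivable (fine \o P) s 1
}.

Definition penalty' (R : realType) (P : R -> \bar R) : R -> R :=
  derive1 (fine \o P).

(* phi_P, which can be -oo. *)
Definition phi (R : realType) (P : R -> \bar R) : \bar R :=
  ereal_inf [set q : \bar R | exists a a' : R,
    [/\ 0 < a, 0 < a', a != a' &
        q = ((penalty' P a - penalty' P a') / (a - a'))%:E]].

Definition nu (R : realType) (P : R -> \bar R) (ell : R) : \bar R :=
  (1 + phi P + ell%:E)%E.

Definition nu_dagger (R : realType) (P : R -> \bar R) (ell : R) : \bar R :=
  maxe (nu P ell) 0%E.

Definition spectral_penalty (R : realType) (m n : nat) (P : R -> \bar R)
    (X : 'M[R]_(m, n)) : \bar R :=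
  (\sum_(i < minn m n) P (singular_value X i))%E.

Definition objective (R : realType) (m n : nat) (Omega : {set 'I_m * 'I_n})
    (Y : 'M[R]_(m, n)) (P : R -> \bar R) (X : 'M[R]_(m, n)) : \bar R :=
  ((2^-1 * frobenius (proj_obs Omega (X - Y)) ^+ 2)%:E
   + spectral_penalty P X)%E.

(* F_ell(X; Xk) *)
Definition surrogate (R : realType) (m n : nat) (Omega : {set 'I_m * 'I_n})
    (Y : 'M[R]_(m, n)) (P : R -> \bar R) (ell : R)
    (Xk X : 'M[R]_(m, n)) : \bar R :=
  ((2^-1 * frobenius (proj_obs Omega (X - Y)) ^+ 2
    + 2^-1 * frobenius (proj_unobs Omega (X - Xk)) ^+ 2
    + ell / 2 * frobenius (X - Xk) ^+ 2)%:E
   + spectral_penalty P X)%E.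

(* Delta_ell(Xk; Xk1) *)
Definition Delta (R : realType) (m n : nat) (Omega : {set 'I_m * 'I_n})
    (P : R -> \bar R) (ell : R) (Xk Xk1 : 'M[R]_(m, n)) : \bar R :=
  ((nu_dagger P ell + ell%:E) * 2^-1%:E * (frobenius (Xk1 - Xk) ^+ 2)%:E
   + (2^-1 * frobenius (proj_unobs Omega (Xk1 - Xk)) ^+ 2)%:E)%E.

Definition argmin (R : realType) (T : Type) (g : T -> \bar R) : set T :=
  [set x | forall y, (g x <= g y)%E].

(* Main.v *)
(* If phi_P is finite, subtracting phi_P s^2 / 2 from P(s) leaves a convex
   nondecreasing function of s >= 0. Its sum over the singular values is a
   convex function of the matrix: by von Neumann's trace inequality, an SVD of
   M turns scalar subgradients at the singular values of M into a subgradient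
   at M. Since the sum of the squared singular values is the squared Frobenius
   norm, the surrogate is nu(ell)-strongly convex whenever nu(ell) > 0, and
   comparing its values at X_k and at its minimizer X_(k+1) yields
   f(X_k) - f(X_(k+1)) >= Delta_ell(X_k; X_(k+1)) (for nu(ell) <= 0 minimality
   alone suffices). Telescoping bounds the sum, hence the minimum, of the
   Delta's. *)

Require Import Defs.
From HB Require Import structures.
From mathcomp Require Import all_boot all_order all_algebra.
From mathcomp Require Import ring lra perm complex polyrcf.
From mathcomp Require Import all_classical all_reals all_analysis.

Set Implicit Arguments.
Unset Strict Implicit.
Unset Printing Implicit Defensive.

Import Order.TTheory GRing.Theory Num.Theory.
Import numFieldNormedType.Exports.

Local Open Scope classical_set_scope.
Local Open Scope ring_scope.

(** * Spectral theorem for real symmetric matrices *)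

(** Over the complex extension [A] is Hermitian, hence unitarily diagonalizable with real diagonal.
    A diagonal entry is an eigenvalue there, and being an eigenvalue descends along the field
    embedding. *)
Lemma symmetric_eigenvalue (R : rcfType) (n : nat) (A : 'M[R]_n.+1) :
  A^T = A -> exists x : R, eigenvalue A x.
Proof.
move=> symA; pose A' := map_mx (real_complex R) A.
have hermA : A' \is hermsymmx.
  apply: realsym_hermsym.
    by apply/is_hermitianmxP; rewrite expr0 scale1r map_mx_id // map_trmx symA.
  by apply/mxOverP => i j; rewrite mxE complex_real.
have /mxOverP/(_ 0 0) sp_real := hermitian_spectral_diag_real hermA.
have /orthomx_spectralP defA := hermitian_normalmx hermA.
have Punit := spectral_unit A'.
pose x := complex.Re (spectral_diag A' 0 0).
have xE : real_complex R x = spectral_diag A' 0 0 by exact: RRe_real.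
exists x; suff : eigenvalue A' (real_complex R x) by rewrite /A' eigenvalue_map.
rewrite xE.
apply/eigenvalueP; exists (row 0 (spectralmx A')).
  rewrite -row_mul {2}defA -!mulmxA mulKVmx //.
  by apply/rowP => j; rewrite mul_diag_mx !mxE.
apply/eqP => /(congr1 (mulmx^~ (invmx (spectralmx A')))).
rewrite -row_mul mulmxV // mul0mx => /rowP/(_ 0); rewrite !mxE eqxx => /eqP.
by rewrite oner_eq0.
Qed.

(* Q is the Householder reflection along v - e_0. *)
Lemma unit_vector_first_column (R : rcfType) (n : nat) (v : 'cV[R]_n.+1) :
  v^T *m v = 1%:M ->
  exists Q : 'M[R]_n.+1, Q^T *m Q = 1%:M /\ Q *m delta_mx 0 0 = v.
Proof.
move=> nv; pose e : 'cV[R]_n.+1 := delta_mx 0 0; pose w := v - e.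
have ee : e^T *m e = 1%:M by rewrite trmx_delta mul_delta_mx [LHS]mx11_scalar mxE.
pose a := (v^T *m e) 0 0.
have ve : v^T *m e = a%:M by exact: mx11_scalar.
have ev : e^T *m v = a%:M by rewrite -[LHS]trmxK trmx_mul trmxK ve tr_scalar_mx.
have we : w^T *m e = (a - 1)%:M.
  by rewrite /w linearB /= mulmxBl ve ee raddfB.
have ww : w^T *m w = (2 * (1 - a))%:M.
  rewrite {2}/w mulmxBr we /w linearB mulmxBl nv ev -!raddfB /=.
  by congr _%:M; ring.
have [a1|a1] := eqVneq a 1.
  exists 1%:M; rewrite trmx1 !mul1mx; split=> //.
  move: ww; rewrite a1 subrr mulr0 => /matrixP/(_ 0 0); rewrite !mxE eqxx mulr1n.
  move/psumr_eq0P => w0.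
  apply/esym/eqP; rewrite -subr_eq0; apply/eqP/colP => i.
  have := w0 (fun i _ => _) i isT; rewrite !mxE -expr2 => h.
  by apply/eqP; rewrite -sqrf_eq0 h // => j; rewrite !mxE -expr2 sqr_ge0.
have b0 : 1 - a != 0 by rewrite subr_eq0 eq_sym.
pose W := w *m w^T; pose Q := 1%:M - (1 - a)^-1 *: W.
have WT : W^T = W by rewrite trmx_mul trmxK.
have WW : W *m W = (2 * (1 - a)) *: W.
  by rewrite /W -mulmxA (mulmxA w^T w) ww mul_scalar_mx scalemxAr.
exists Q; split.
  have -> : Q^T = Q by rewrite /Q linearB /= linearZ /= trmx1 WT.
  rewrite /Q.
  rewrite mulmxBl mul1mx mulmxBr mulmx1 -scalemxAl -scalemxAr WW !scalerA.
  rewrite (_ : _ * (_ * _) = 2 * (1 - a)^-1); last by field.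
  by rewrite mulr_natl mulr2n scalerDl opprB addrK subrK.
rewrite -/e /Q mulmxBl mul1mx /W -scalemxAl -mulmxA we mul_mx_scalar scalerA.
rewrite -[a - 1]opprB mulrN mulVf // scaleN1r opprK /w addrC subrK.
by [].
Qed.

(** Deflation: an orthogonal [Q] sends the first basis vector to a unit eigenvector. By symmetry
    [Q^T *m A *m Q] splits into a 1x1 block and a smaller symmetric block, to which induction
    applies. *)
Lemma symmetric_diagonalizable (R : rcfType) (n : nat) (A : 'M[R]_n) :
  A^T = A -> exists (V : 'M[R]_n) (d : 'rV[R]_n),
    V^T *m V = 1%:M /\ A = V *m diag_mx d *m V^T.
Proof.
elim: n A => [|n IHn] A symA.
  by exists 1%:M, 0; split; apply/matrixP => -[].
have [x /eigenvalueP[u uA u0]] := symmetric_eigenvalue symA.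
pose c := (u *m u^T) 0 0.
have uu : u *m u^T = c%:M by exact: mx11_scalar.
have c_gt0 : 0 < c.
  rewrite /c mxE; under eq_bigr do rewrite mxE -expr2.
  rewrite lt_def sumr_ge0 ?andbT => [|i _]; last exact: sqr_ge0.
  apply: contra u0 => /eqP/psumr_eq0P h; apply/eqP/rowP => i.
  by rewrite mxE; apply/eqP; rewrite -sqrf_eq0 h // => j _; exact: sqr_ge0.
pose v := (Num.sqrt c)^-1 *: u^T.
have vv : v^T *m v = 1%:M.
  have -> : v^T = (Num.sqrt c)^-1 *: u.
    by rewrite /v linearZ /= trmxK.
  rewrite -scalemxAl -scalemxAr scalerA.
  rewrite uu scale_scalar_mx -invfM -expr2 sqr_sqrtr ?ltW//.
  by rewrite mulVf ?gt_eqF.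
have Av : A *m v = x *: v.
  by rewrite -{1}symA /v -scalemxAr -trmx_mul uA linearZ /= !scalerA mulrC.
have [Q [QQ Qv]] := unit_vector_first_column vv.
have QQ' : Q *m Q^T = 1%:M by exact: mulmx1C.
pose B : 'M[R]_(1 + n) := Q^T *m A *m Q.
have symB : B^T = B by rewrite /B !trmx_mul trmxK symA mulmxA.
have Be : (B : 'M[R]_n.+1) *m delta_mx 0 0 = x *: (delta_mx 0 0 : 'cV[R]_n.+1).
  by rewrite /B -mulmxA Qv -mulmxA Av -scalemxAr -Qv mulmxA QQ mul1mx.
have defA : A = Q *m B *m Q^T.
  by rewrite /B -!mulmxA QQ' mulmx1 !mulmxA QQ' mul1mx.
clearbody B.
have B0 : ulsubmx B = x%:M /\ dlsubmx B = 0.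
  have l0 : lshift n (0 : 'I_1) = 0 :> 'I_n.+1 by exact: val_inj.
  have Bi0 i : B i (lshift n 0) = x *+ (i == lshift n 0).
    have /colP/(_ i) := Be; rewrite -colE !mxE andbT -l0 => ->.
    by rewrite mulr_natr.
  by split; apply/matrixP => i j; rewrite !mxE !ord1 Bi0 -?val_eqE ?mulr0n.
have [ulB dlB] := B0.
have urB : ursubmx B = 0.
  by rewrite -symB -trmx_dlsub dlB trmx0.
have [V [d [VV defD]]] := IHn (drsubmx B) ltac:(by rewrite trmx_drsub symB).
have defB : B = block_mx x%:M 0 0 (drsubmx B).
  by rewrite -[LHS]submxK ulB urB dlB.
pose W : 'M[R]_(1 + n) := block_mx 1%:M 0 0 V.
have WT : W^T = block_mx 1%:M 0 0 V^T by rewrite tr_block_mx !trmx0 trmx1.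
have WW : W^T *m W = 1%:M.
  rewrite WT mulmx_block !mulmx0 !mul0mx !mulmx1 !addr0 add0r VV.
  by rewrite -scalar_mx_block.
have WdW : B = W *m diag_mx (row_mx x%:M d) *m W^T.
  rewrite {1}defB defD WT diag_mx_row !mulmx_block.
  rewrite !mulmx0 !mul0mx !mulmx1 !mul1mx !addr0 !add0r ?mul0mx; congr block_mx.
  by apply/matrixP => i j; rewrite !ord1 !mxE.
exists (Q *m W), (row_mx x%:M d); split.
  by rewrite trmx_mul -mulmxA (mulmxA (Q^T)) QQ mul1mx WW.
by rewrite defA WdW trmx_mul !mulmxA.
Qed.

(** When [p] splits, the multiplicity of a root is its number of occurrences in [s], so listing the
    distinct roots with multiplicity recovers [s] up to order. *)
Lemma perm_eq_prod_XsubC (R : rcfType) (s : seq R) (p : {poly R}) :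
  p = \prod_(x <- s) ('X - x%:P) ->
  perm_eq (flatten [seq nseq (mup x p) x | x <- rootsR p]) s.
Proof.
move=> defp; have p0 : p != 0.
  by rewrite defp monic_neq0 // monic_prod_XsubC.
have mup_count y : mup y p = count_mem y s.
  rewrite defp; elim: s {p defp p0} => [|x s IHs].
    by rewrite big_nil mupNroot // root1.
  rewrite big_cons mupM ?polyXsubC_eq0 ?monic_neq0 ?monic_prod_XsubC //.
  by rewrite IHs -['X - _]expr1 mup_XsubCX /= eq_sym; case: eqP.
have rootE y : (y \in rootsR p) = (y \in s).
  by have := roots_on_rootsR p0 y; rewrite in_itv /= => <-;
    rewrite defp root_prod_XsubC.
have u : uniq (rootsR p) by exact: uniq_roots.
apply/allP => y _ /=; apply/eqP.
(* Only the block of copies of [y] itself contributes to the count of [y]. *)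
rewrite count_flatten -map_comp sumnE big_map.
rewrite (eq_bigr (fun x => if x == y then count_mem y s else 0))%N; last first.
  move=> x _ /=; rewrite count_nseq /= mup_count.
  case: eqP => [->|]; last by rewrite mul0n.
  by rewrite mul1n.
rewrite -big_mkcond /= big_const_seq.
rewrite -(@eq_count _ (pred1 y)) // count_uniq_mem // rootE.
case: (boolP (y \in s)) => [_|/count_memPn ->] //=.
by rewrite addn0.
Qed.

Lemma char_poly_orthogonal_diag (R : rcfType) (n : nat) (V : 'M[R]_n)
    (d : 'rV[R]_n) : V^T *m V = 1%:M ->
  char_poly (V *m diag_mx d *m V^T) = \prod_(x <- codom (d 0)) ('X - x%:P).
Proof.
move=> VV; have VV' : V *m V^T = 1%:M by exact: mulmx1C.
rewrite big_image /= /char_poly /char_poly_mx.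
have -> : 'X%:M - map_mx (@polyC R) (V *m diag_mx d *m V^T) =
  map_mx (@polyC R) V *m ('X%:M - map_mx (@polyC R) (diag_mx d)) *m
  map_mx (@polyC R) V^T.
  rewrite mulmxBr mulmxBl -!map_mxM mul_mx_scalar -scalemxAl -map_mxM VV'.
  by rewrite map_mx1 scalemx1.
rewrite !det_mulmx mulrAC -det_mulmx -map_mxM VV' map_mx1 det1 mul1r.
rewrite -[LHS]/(char_poly (diag_mx d)) char_poly_trig ?diag_mx_is_trig//.
by apply: eq_bigr => i _; rewrite mxE eqxx.
Qed.

(** Any orthogonal diagonalization has the eigenvalues on its diagonal in some order; permuting the
    columns of [V] puts them in the sorted order of [eigenvalues]. *)
Lemma symmetric_spectral (R : realType) (n : nat) (A : 'M[R]_n) : A^T = A ->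
  size (eigenvalues A) = n /\
  exists V : 'M[R]_n, V^T *m V = 1%:M /\
    A = V *m diag_mx (\row_i (eigenvalues A)`_i) *m V^T.
Proof.
move=> /symmetric_diagonalizable[V [d [VV defA]]].
pose t : n.-tuple R := [tuple d 0 i | i < n].
have pt : perm_eq (eigenvalues A) t.
  rewrite perm_sort; apply: perm_eq_prod_XsubC.
  by rewrite [in LHS]defA char_poly_orthogonal_diag.
split; first by rewrite (perm_size pt) size_tuple.
have /tuple_permP[p defe] := pt.
have eE (i : 'I_n) : (eigenvalues A)`_i = d 0 (p i).
  by rewrite defe -tnth_nth !tnth_mktuple.
exists (col_perm p V); split.
  rewrite tr_col_perm; apply/matrixP => i j.
  transitivity ((V^T *m V) (p i) (p j)).
    by rewrite !mxE; apply: eq_bigr => k _; rewrite !mxE.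
  by rewrite VV !mxE (inj_eq perm_inj).
rewrite {1}defA; apply/matrixP => i j.
rewrite !mul_mx_diag !mxE (reindex_inj (@perm_inj _ p)) /=.
by apply: eq_bigr => k _; rewrite !mxE eE.
Qed.

Lemma eigenvalues_nonincreasing (R : realType) (n : nat) (A : 'M[R]_n)
    (i j : nat) : (i <= j < size (eigenvalues A))%N ->
  (eigenvalues A)`_j <= (eigenvalues A)`_i.
Proof.
move=> /andP[ij js].
have h : sorted (fun x y : R => y <= x) (eigenvalues A).
  by apply: sort_sorted => x y; exact: le_total.
apply: (sorted_leq_nth _ _ 0 h) => //; rewrite ?inE //.
- by move=> x y z yx zy; exact: le_trans zy yx.
- exact: leq_ltn_trans js.
Qed.

(** * Singular values *)

Lemma tr_gramE (R : comNzRingType) (m n : nat) (Z : 'M[R]_(m, n)) :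
  \tr (Z^T *m Z) = \sum_(i < m) \sum_(j < n) Z i j ^+ 2.
Proof.
rewrite exchange_big; apply: eq_bigr => j _; rewrite mxE.
by apply: eq_bigr => i _; rewrite !mxE expr2.
Qed.

Lemma tr_gram_ge0 (R : realDomainType) (m n : nat) (Z : 'M[R]_(m, n)) :
  0 <= \tr (Z^T *m Z).
Proof.
by rewrite tr_gramE sumr_ge0 // => i _; rewrite sumr_ge0 // => j _;
  exact: sqr_ge0.
Qed.

(** This weakens orthonormality of the columns to allow null ones: the left factor of the SVD below
    is m x n, with a zero column for each zero singular value. *)
Definition partial_isometry (R : nzRingType) (m n : nat) (A : 'M[R]_(m, n)) :=
  A *m A^T *m A = A.

Lemma partial_isometry_tr (R : comNzRingType) (m n : nat) (A : 'M[R]_(m, n)) :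
  partial_isometry A -> partial_isometry A^T.
Proof.
rewrite /partial_isometry => h.
by rewrite -[X in _ = X^T]h !trmx_mul trmxK mulmxA.
Qed.

(** [A *m A^T] is an orthogonal projection. With [Q] the complementary one, the difference of the
    two sides is the squared norm of [Q *m U]. *)
Lemma partial_isometry_contraction (R : realDomainType) (m n p : nat)
    (A : 'M[R]_(m, n)) (U : 'M[R]_(m, p)) : partial_isometry A ->
  \tr ((A^T *m U)^T *m (A^T *m U)) <= \tr (U^T *m U).
Proof.
move=> hA; pose Q := 1%:M - A *m A^T.
have QT : Q^T = Q by rewrite /Q linearB /= trmx1 trmx_mul trmxK.
have QQ : Q *m Q = Q.
  rewrite {1}/Q mulmxBl mul1mx /Q mulmxBr mulmx1 mulmxA hA subrr subr0.
  by [].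
rewrite -subr_ge0.
suff -> : \tr (U^T *m U) - \tr ((A^T *m U)^T *m (A^T *m U)) =
    \tr ((Q *m U)^T *m (Q *m U)) by exact: tr_gram_ge0.
rewrite [in RHS]trmx_mul -mulmxA (mulmxA (Q^T)) QT QQ /Q mulmxBl mul1mx mulmxBr.
by rewrite raddfB /= trmx_mul trmxK !mulmxA.
Qed.

(** The column is the image of a basis vector under the two contractions [A] and [B^T]. *)
Lemma sum_sqr_col_le1 (R : realDomainType) (m n p : nat) (A : 'M[R]_(m, n))
    (B : 'M[R]_(m, p)) (j : 'I_n) : partial_isometry A -> partial_isometry B ->
  \sum_(i < p) (B^T *m A) i j ^+ 2 <= 1.
Proof.
move=> /partial_isometry_tr hA hB; pose e : 'cV[R]_n := delta_mx j 0.
have := partial_isometry_contraction e hA; rewrite trmxK.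
move/(le_trans (partial_isometry_contraction (A *m e) hB)).
have -> : \tr (e^T *m e) = 1.
  by rewrite trmx_delta mul_delta_mx trace_mx11 mxE.
rewrite tr_gramE.
rewrite mulmxA -colE; congr (_ <= _).
by apply: eq_bigr => i _; rewrite big_ord1 mxE.
Qed.

(** Summation by parts: as the total of [d] is nonnegative, the weight on the left may be raised
    from [c n.+1] to [c n]; the last terms then cancel. *)
Lemma abel_sum_ge (R : realDomainType) (n : nat) (c : nat -> R) (d : 'I_n -> R) :
  (forall i, c i.+1 <= c i) ->
  (forall p, (p <= n)%N -> 0 <= \sum_(i < n | (i < p)%N) d i) ->
  c n * \sum_(i < n) d i <= \sum_(i < n) c i * d i.
Proof.
move=> cS; elim: n d => [|n IHn] d hd; first by rewrite !big_ord0 mulr0.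
have := hd n.+1 (leqnn _); rewrite (eq_bigl xpredT) => [dn|i]; last exact: ltn_ord.
apply: (@le_trans _ _ (c n * \sum_(i < n.+1) d i)).
  exact: ler_wpM2r.
rewrite !big_ord_recr /= mulrDr lerD2r; apply: IHn => p pn.
have := hd p (leqW pn); rewrite big_mkcond big_ord_recr /= ltnNge pn /= addr0.
by rewrite -big_mkcond.
Qed.

Lemma abel_sum_le (R : realDomainType) (n : nat) (c : nat -> R)
    (a b : 'I_n -> R) :
  (forall i, c i.+1 <= c i) -> 0 <= c n ->
  (forall p, (p <= n)%N ->
    \sum_(i < n | (i < p)%N) a i <= \sum_(i < n | (i < p)%N) b i) ->
  \sum_(i < n) c i * a i <= \sum_(i < n) c i * b i.
Proof.
move=> cS cn hab; rewrite -subr_ge0 -sumrB.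
under eq_bigr do rewrite -mulrBr.
apply: le_trans (abel_sum_ge cS _) => [|p pn].
  rewrite mulr_ge0 //; have := hab n (leqnn _).
  rewrite -subr_ge0 -sumrB (eq_bigl xpredT) // => i; exact: ltn_ord.
by rewrite sumrB subr_ge0; exact: hab.
Qed.

(** Abel summation in [i], then in [j], reduces the claim to the case where [c] and [s] are
    indicators of initial segments of lengths [p] and [q]. *)
Lemma doubly_substochastic_le (R : realDomainType) (n : nat) (c s : nat -> R)
    (S : 'I_n -> 'I_n -> R) :
  (forall i, c i.+1 <= c i) -> 0 <= c n ->
  (forall i, s i.+1 <= s i) -> 0 <= s n ->
  (forall i j, 0 <= S i j) ->
  (forall i, \sum_j S i j <= 1) -> (forall j, \sum_i S i j <= 1) ->
  \sum_(i < n) \sum_(j < n) c i * s j * S i j <= \sum_(i < n) c i * s i.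
Proof.
move=> cS cn sS sn S0 Sr Sc.
have sub_le (F : 'I_n -> R) p : (forall i, 0 <= F i) -> \sum_i F i <= 1 ->
    \sum_(i < n | (i < p)%N) F i <= 1.
  move=> F0; apply: le_trans; rewrite [leRHS](bigID (fun i : 'I_n => (i < p)%N)).
  by rewrite lerDl sumr_ge0.
under eq_bigr do under eq_bigr do rewrite -mulrA.
under eq_bigr do rewrite -mulr_sumr.
apply: abel_sum_le => // p _; rewrite exchange_big /=.
under eq_bigr do rewrite -mulr_sumr.
rewrite (_ : \sum_(i < n | _) s i = \sum_(i < n) s i * (i < p)%:R); last first.
  by rewrite big_mkcond; apply: eq_bigr => i _; case: ifP; rewrite ?mulr1 ?mulr0.
apply: (abel_sum_le (b := fun i : 'I_n => (i < p)%:R)) => // q _.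
(* The corner block of [S] with [p] rows and [q] columns has sum at most [minn p q]: use row sums
   when [p <= q], column sums otherwise. *)
have [pq|/ltnW qp] := leqP p q.
  rewrite exchange_big /=; apply: (@le_trans _ _ (\sum_(i < n | (i < p)%N) 1)).
    by apply: ler_sum => i _; exact: sub_le.
  rewrite [leLHS]big_mkcond [leRHS]big_mkcond /=; apply: ler_sum => i _.
  by case: ltnP => ip; [rewrite (leq_trans ip) | case: ifP].
apply: ler_sum => j jq; rewrite (leq_trans jq) //.
exact: sub_le.
Qed.

(** The trace expands to the sum of [c i * s j * (G i j * H i j)]. Bounding each product by the mean
    of the squares leaves a doubly substochastic matrix, as rows and columns of [G] and [H] have
    norm at most 1. *)
Lemma von_neumann_trace_le (R : realFieldType) (m n : nat) (A B : 'M[R]_(m, n))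
    (U V : 'M[R]_n) (c s : nat -> R) :
  partial_isometry A -> partial_isometry B ->
  partial_isometry U -> partial_isometry V ->
  (forall i, c i.+1 <= c i) -> 0 <= c n ->
  (forall i, s i.+1 <= s i) -> 0 <= s n ->
  \tr ((B *m diag_mx (\row_i c i) *m U^T)^T *m
       (A *m diag_mx (\row_i s i) *m V^T)) <= \sum_(i < n) c i * s i.
Proof.
move=> hA hB hU hV cS cn sS sn.
pose G := B^T *m A; pose H := U^T *m V.
have nonneg (f : nat -> R) (i : 'I_n) : (forall i, f i.+1 <= f i) -> 0 <= f n ->
    0 <= f i.
  move=> fS /le_trans; apply.
  by apply: (homo_leq (r := fun x y => y <= x)) (ltnW (ltn_ord i)) => //
    x y z yx zy; exact: le_trans zy yx.
apply: le_trans (doubly_substochastic_le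
  (S := fun i j => (G i j ^+ 2 + H i j ^+ 2) / 2)
  cS cn sS sn _ _ _) => [|i j|i|j]; last 3 first.
- by rewrite divr_ge0 // addr_ge0 // sqr_ge0.
- rewrite -mulr_suml big_split /= ler_pdivrMr // mul1r [leRHS]mulr2n.
  have tr_row (p q : nat) (C : 'M[R]_(p, q)) (k : 'I_p) :
      \sum_j C k j ^+ 2 = \sum_j C^T j k ^+ 2.
    by apply: eq_bigr => j _; rewrite mxE.
  by rewrite !tr_row lerD // trmx_mul trmxK; exact: sum_sqr_col_le1.
- rewrite -mulr_suml big_split /= ler_pdivrMr // mul1r [leRHS]mulr2n.
  by rewrite lerD //; exact: sum_sqr_col_le1.
rewrite !trmx_mul trmxK tr_diag_mx -!mulmxA mxtrace_mulC -!mulmxA.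
rewrite -[V^T *m U]trmxK trmx_mul trmxK -/H (mulmxA B^T) -/G.
clearbody G H; rewrite mulmxA !mul_diag_mx.
apply: ler_sum => i _; rewrite mxE; apply: ler_sum => j _.
rewrite !mxE.
have -> : c i * G i j * (s j * H i j) = c i * s j * (G i j * H i j) by ring.
apply: ler_wpM2l; first by rewrite mulr_ge0 ?nonneg.
have := sqr_ge0 (G i j - H i j); lra.
Qed.

(** * Singular value decomposition and spectral subgradients *)

Section SingularValues.
Variables (R : realType) (m n : nat).
Implicit Type X : 'M[R]_(m, n).

Lemma gram_sym X : (X^T *m X)^T = X^T *m X.
Proof. by rewrite trmx_mul trmxK. Qed.

Lemma singular_value_ge0 X i : 0 <= singular_value X i.
Proof. exact: sqrtr_ge0. Qed.

Lemma singular_value_nonincreasing X i j :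
  (i <= j)%N -> singular_value X j <= singular_value X i.
Proof.
move=> ij; have [js|js] := ltnP j (size (eigenvalues (X^T *m X))).
  by rewrite ler_wsqrtr // eigenvalues_nonincreasing // ij.
by rewrite {1}/singular_value nth_default // sqrtr0 singular_value_ge0.
Qed.

(** The columns of [W = X *m V] are orthogonal with norms the singular values; [A] is obtained by
    normalizing the nonzero ones. *)
Lemma svd X : exists (A : 'M[R]_(m, n)) (V : 'M[R]_n),
  [/\ V^T *m V = 1%:M, partial_isometry A,
      A^T *m A = diag_mx (\row_j (singular_value X j != 0)%:R) &
      X = A *m diag_mx (\row_j singular_value X j) *m V^T].
Proof.
have [_ [V [VV defXX]]] := symmetric_spectral (gram_sym X).
have VV' : V *m V^T = 1%:M by exact: mulmx1C.
set s := singular_value X; pose W := X *m V.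
have WW : W^T *m W = diag_mx (\row_j (s j) ^+ 2).
  have WWe : W^T *m W = diag_mx (\row_i (eigenvalues (X^T *m X))`_i).
    by rewrite trmx_mul -mulmxA (mulmxA (X^T)) {1}defXX -!mulmxA VV mulmx1 mulmxA
      VV mul1mx.
  rewrite WWe; congr diag_mx; apply/rowP => j; rewrite !mxE sqr_sqrtr //.
  have /matrixP/(_ j j) := WWe; rewrite [RHS]mxE eqxx !mxE mulr1n => <-.
  by apply: sumr_ge0 => i _; rewrite !mxE -expr2 sqr_ge0.
(* Since [0^-1 = 0], columns for zero singular values become null. *)
pose A := W *m diag_mx (\row_j (s j)^-1).
have AA : A^T *m A = diag_mx (\row_j (s j != 0)%:R).
  rewrite /A trmx_mul tr_diag_mx -mulmxA (mulmxA (W^T)) WW !mulmx_diag.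
  congr diag_mx; apply/rowP => j; rewrite !mxE.
  by have [->|s0] := eqVneq (s j) 0; rewrite ?invr0 ?mul0r //=; field.
exists A, V; split=> //.
  rewrite /partial_isometry -mulmxA AA /A -mulmxA mulmx_diag.
  congr (_ *m diag_mx _); apply/rowP => j; rewrite !mxE.
  by have [->|s0] := eqVneq (s j) 0; rewrite ?invr0 ?mul0r // mulr1.
rewrite /A -(mulmxA W) mulmx_diag.
suff -> : W *m diag_mx (\row_j ((\row_i (s i)^-1) 0 j * (\row_i s i) 0 j)) = W.
  by rewrite /W -mulmxA VV' mulmx1.
apply/matrixP => i j; rewrite mul_mx_diag [LHS]mxE.
have -> : (\row_j ((\row_i (s i)^-1) 0 j * (\row_i s i) 0 j)) 0 j =
    (s j)^-1 * s j by rewrite !mxE.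
(* If [s j] is zero, column [j] of [W] has squared norm 0, so nothing is lost by scaling it by 0. *)
have [s0|s0] := eqVneq (s j) 0; last by rewrite mulVf ?mulr1.
have /psumr_eq0P h : \sum_k W^T j k * W k j = 0.
  by have /matrixP/(_ j j) := WW; rewrite mxE => ->; rewrite !mxE s0 expr0n mul0rn.
have -> : W i j = 0.
  apply/eqP; rewrite -sqrf_eq0 expr2 -{1}[W]trmxK mxE h // => k _.
  by rewrite mxE -expr2 sqr_ge0.
by rewrite mul0r.
Qed.

(** Past [n] the value is the default of [nth]. For [m <= i < n], the trace of [A^T *m A] counts the
    nonzero singular values and is at most [m], whereas a nonzero one at [i] would force [i.+1] of
    them by monotonicity. *)
Lemma singular_value_eq0 X i : (minn m n <= i)%N -> singular_value X i = 0.
Proof.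
rewrite geq_min => /orP[mi|ni]; last first.
  rewrite /singular_value nth_default ?sqrtr0 //.
  by have [-> _] := symmetric_spectral (gram_sym X).
have [ni|i_n] := leqP n i.
  rewrite /singular_value nth_default ?sqrtr0 //.
  by have [-> _] := symmetric_spectral (gram_sym X).
have [A [V [_ hA AA _]]] := svd X.
apply/eqP; apply: contraTT mi => s0; rewrite -ltnNge.
have : \tr (A^T *m A) <= m%:R.
  rewrite mxtrace_mulC -{1}[A]trmxK -[A^T]mulmx1 -[m%:R]mxtrace1.
  rewrite -[X in _ <= \tr X]mulmx1 -[X in _ <= \tr (X *m _)]trmx1.
  exact: partial_isometry_contraction.
rewrite AA mxtrace_diag; apply: contraTT; rewrite -leqNgt -ltNge => mi.
apply: (@lt_le_trans _ _ (\sum_(j < n | (j < i.+1)%N) 1)).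
  by rewrite -(big_ord_widen n (fun=> 1)) // sumr_const card_ord ltr_nat ltnS.
rewrite big_mkcond; apply: ler_sum => j _; rewrite mxE.
case: ifP => // ji; rewrite (_ : _ != 0) //.
rewrite gt_eqF // (lt_le_trans _ (singular_value_nonincreasing X (j := i) _)) //.
by rewrite lt_def s0 singular_value_ge0.
Qed.

Lemma sum_minn (f : nat -> R) : (forall i, (minn m n <= i)%N -> f i = 0) ->
  \sum_(i < minn m n) f i = \sum_(i < n) f i.
Proof.
move=> f0; rewrite (big_ord_widen n f) ?geq_minr // big_mkcond.
by apply: eq_bigr => i _; case: ltnP => // /f0.
Qed.

Lemma sum_sqr_singular_value X :
  \sum_(i < minn m n) singular_value X i ^+ 2 = \tr (X^T *m X).
Proof.
have [A [V [VV _ AA defX]]] := svd X.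
rewrite (sum_minn (f := fun i => singular_value X i ^+ 2)) => [|i hi]; last first.
  by rewrite singular_value_eq0 // expr0n.
rewrite [X in X^T *m _]defX [X in _ *m X]defX !trmx_mul trmxK tr_diag_mx.
rewrite -!mulmxA mxtrace_mulC -!mulmxA VV mulmx1 (mulmxA (A^T)) AA !mulmx_diag.
rewrite mxtrace_diag; apply: eq_bigr => i _; rewrite !mxE.
by have [->|] := eqVneq (singular_value X i) 0; rewrite ?expr0n /= ?mul0r // mul1r.
Qed.

(** [G] has the singular vectors of [M] and the values of [g] at its singular values. The trace of
    [G^T *m M] is then an exact weighted sum, that of [G^T *m X] is bounded by von Neumann's
    inequality, and the scalar subgradient inequalities add up. The condition [g 0 = 0] makes the
    weights vanish from [minn m n] on. *)
Lemma spectral_subgradient (h g : R -> R) (M : 'M[R]_(m, n)) :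
  g 0 = 0 -> (forall x y, 0 <= x -> x <= y -> g x <= g y) ->
  (forall x y, 0 <= x -> 0 <= y -> h y + g y * (x - y) <= h x) ->
  exists G : 'M[R]_(m, n), forall X,
    \sum_(i < minn m n) h (singular_value M i) + \tr (G^T *m (X - M)) <=
    \sum_(i < minn m n) h (singular_value X i).
Proof.
move=> g0 gle hg; have [B [U [UU hB BB defM]]] := svd M.
pose c i := g (singular_value M i).
have c0 i : (minn m n <= i)%N -> c i = 0.
  by move=> hi; rewrite /c singular_value_eq0.
pose G := B *m diag_mx (\row_i c i) *m U^T.
have GM : \tr (G^T *m M) = \sum_(i < minn m n) c i * singular_value M i.
  rewrite (sum_minn (f := fun i => c i * singular_value M i)) => [|i /c0 ->];
    last by rewrite mul0r.
  rewrite [X in _ *m X]defM /G !trmx_mul trmxK tr_diag_mx.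
  rewrite -!mulmxA mxtrace_mulC -!mulmxA UU mulmx1 (mulmxA (B^T)) BB !mulmx_diag.
  rewrite mxtrace_diag; apply: eq_bigr => i _; rewrite !mxE.
  by have [->|] := eqVneq (singular_value M i) 0; rewrite ?mulr0 // mul1r.
exists G => X.
have GX : \tr (G^T *m X) <= \sum_(i < minn m n) c i * singular_value X i.
  have [A [V [VV hA _ defX]]] := svd X.
  rewrite (sum_minn (f := fun i => c i * singular_value X i)) => [|i /c0 ->];
    last by rewrite mul0r.
  rewrite [X in _ *m X]defX; apply: von_neumann_trace_le => //.
  - by rewrite /partial_isometry -mulmxA UU mulmx1.
  - by rewrite /partial_isometry -mulmxA VV mulmx1.
  - move=> i; apply: gle; first exact: singular_value_ge0.
    exact: singular_value_nonincreasing.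
  - by rewrite c0 // geq_minr.
  - by move=> i; exact: singular_value_nonincreasing.
  - exact: singular_value_ge0.
rewrite mulmxBr raddfB /= GM -lerBrDl -sumrB.
apply: le_trans (lerB GX (lexx _)) _; rewrite -sumrB.
apply: ler_sum => i _; rewrite -mulrBr lerBrDl.
by apply: hg; exact: singular_value_ge0.
Qed.

End SingularValues.

(** * Penalty functions *)

Section Penalty.
Variables (R : realType) (P : R -> \bar R) (hP : penalty P).
Let p : R -> R := fine \o P.

Lemma penalty_mean_value (r a b : R) : 0 <= a -> a < b ->
  exists2 c, c \in `]a, b[ &
    (p b - r / 2 * b ^+ 2) - (p a - r / 2 * a ^+ 2) =
    (penalty' P c - r * c) * (b - a).
Proof.
move=> a0 ab; pose h s := p s - r / 2 * s ^+ 2.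
have dq (x : R) : is_derive x (1 : R) (fun s : R => r / 2 * s ^+ 2) (r * x).
  apply: (@is_derive_eq _ _ _ (fun s : R => r / 2 * s ^+ 2)).
  by rewrite /GRing.scale /= mulr1; field.
have dh (x : R) : 0 < x -> is_derive x (1 : R) h (penalty' P x - r * x).
  move=> x0; have dp : is_derive x (1 : R) p (penalty' P x).
    rewrite /penalty' derive1E; apply: DeriveDef => //.
    exact: penalty_derivable.
  exact: is_deriveB.
have ch (x : R) : 0 < x -> h s @[s --> x] --> h x.
  move=> /dh[dhx _]; exact/differentiable_continuous/derivable1_diffP.
have cq (x : R) : {for x, continuous (fun s : R => r / 2 * s ^+ 2)}.
  by have [dqx _] := dq x; exact/differentiable_continuous/derivable1_diffP.
apply: (MVT (f := h) (df := fun x => penalty' P x - r * x) ab).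
  by move=> x; rewrite in_itv /= => /andP[ax _]; apply: dh; exact: le_lt_trans ax.
apply/continuous_within_itvP => //; split.
- by move=> x; rewrite in_itv /= => /andP[ax _]; apply: ch; exact: le_lt_trans ax.
(* At the endpoint 0 there is no derivative to rely on, only right continuity. *)
- have [a1|a1] := eqVneq a 0; last first.
    by apply: cvg_at_right_filter; apply: ch; rewrite lt_def a1.
  rewrite a1; apply: cvgB; last by apply: cvg_at_right_filter; exact: cq.
  apply: fine_cvg; rewrite /p /= fineK ?penalty_fin_num //.
  exact: penalty_right_continuous0.
- by apply: cvg_at_left_filter; apply: ch; exact: le_lt_trans ab.
Qed.

Lemma fine_penalty_le (x y : R) : 0 <= x -> x <= y -> p x <= p y.
Proof.
move=> x0 xy; have y0 := le_trans x0 xy.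
by rewrite fine_le ?penalty_fin_num // penalty_nondecreasing.
Qed.

Variables (r : R) (phiE : phi P = r%:E).

Definition curved_penalty (s : R) : R := p s - r / 2 * s ^+ 2.

(* A subgradient of [curved_penalty] at every s >= 0. The slope at 0, where the
   right derivative may be infinite, is 0 so that null singular values drop out
   of the matrix subgradient. *)
Definition curved_penalty' (s : R) : R :=
  if s == 0 then 0 else penalty' P s - r * s.

(** Every difference quotient of [penalty' P] on positive points is at least [phi P], that is,
    [r]. *)
Let curved_penalty'_pos_le (x y : R) : 0 < x -> x <= y ->
  penalty' P x - r * x <= penalty' P y - r * y.
Proof.
move=> x0; rewrite le_eqVlt => /predU1P[->//|xy].
have y0 := lt_trans x0 xy.
have : (r%:E <= ((penalty' P y - penalty' P x) / (y - x))%:E)%E.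
  by rewrite -phiE; apply: ereal_inf_lbound; exists y, x; rewrite gt_eqF.
rewrite lee_fin ler_pdivlMr ?subr_gt0 //; lra.
Qed.

(** Compared with the slope 0 chosen at 0, the claim is that the slope at [y] is nonnegative; this
    comes from the monotonicity of the penalty. *)
Lemma curved_penalty'_le (x y : R) : 0 <= x -> x <= y ->
  curved_penalty' x <= curved_penalty' y.
Proof.
rewrite /curved_penalty' le_eqVlt => /predU1P[<-|x0] xy; last first.
  by rewrite !gt_eqF ?(lt_le_trans x0) //; exact: curved_penalty'_pos_le.
rewrite eqxx; case: eqVneq => // y_neq0.
have y0 : 0 < y by rewrite lt_def y_neq0.
(* By the mean value theorem, P' >= 0 somewhere in every interval ]0, e[. *)
rewrite leNgt; apply/negP => gy.
have small e : 0 < e -> e <= y ->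
    exists2 c, 0 < c < e & - r * c <= penalty' P y - r * y.
  move=> e0 ey; have [c] := penalty_mean_value 0 (lexx 0) e0.
  rewrite in_itv /= !mul0r !subr0 => /andP[c0 ce] pe; exists c; first by rewrite c0.
  apply: le_trans (curved_penalty'_pos_le c0 (le_trans (ltW ce) ey)).
  rewrite mulNr lerBrDr addNr -(pmulr_lge0 _ e0) -pe subr_ge0.
  exact: fine_penalty_le (ltW e0).
have [r0|r0] := leP r 0.
  have [c /andP[c0 _] hc] := small y y0 (lexx y).
  have : 0 <= - r * c by rewrite mulr_ge0 ?oppr_ge0 // ltW.
  lra.
pose e := Num.min y (- (penalty' P y - r * y) / r).
(* The bound [c < e] gives [- r * c > penalty' P y - r * y], against [small]. *)
have e0 : 0 < e by rewrite lt_min y0 divr_gt0 ?oppr_gt0.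
have ey : e <= y by rewrite ge_min lexx.
have [c /andP[c0]] := small e e0 ey.
rewrite lt_min ltr_pdivlMr // => /andP[_]; lra.
Qed.

(** The mean value theorem gives the increment as the slope at an intermediate point times [x - y];
    monotonicity compares that slope with the one at [y]. *)
Lemma curved_penalty_subgradient (x y : R) : 0 <= x -> 0 <= y ->
  curved_penalty y + curved_penalty' y * (x - y) <= curved_penalty x.
Proof.
move=> x0 y0; have gE c : 0 < c -> penalty' P c - r * c = curved_penalty' c.
  by rewrite /curved_penalty' => /gt_eqF ->.
rewrite -lerBrDl; have [xy|yx|<-] := ltgtP x y; last by rewrite !subrr mulr0.
- have [c] := penalty_mean_value r x0 xy; rewrite in_itv /= => /andP[xc cy].
  rewrite -/(curved_penalty _) -/(curved_penalty _) => e.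
  rewrite -[leRHS]opprB e gE ?(le_lt_trans x0) // -[y - x]opprB mulrN opprK.
  rewrite ler_nM2r ?subr_lt0 //.
  by apply: curved_penalty'_le; rewrite ltW // (le_lt_trans x0).
- have [c] := penalty_mean_value r y0 yx; rewrite in_itv /= => /andP[yc cx].
  rewrite -/(curved_penalty _) -/(curved_penalty _) => ->.
  rewrite gE ?(le_lt_trans y0) // ler_pM2r ?subr_gt0 //.
  by apply: curved_penalty'_le => //; exact: ltW.
Qed.

End Penalty.

(** * Convexity along segments *)

Lemma frobenius_sqr (R : realType) (m n : nat) (X : 'M[R]_(m, n)) :
  frobenius X ^+ 2 = \sum_(i < m) \sum_(j < n) X i j ^+ 2.
Proof.
by rewrite sqr_sqrtr // sumr_ge0 // => i _; rewrite sumr_ge0 // => j _;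
  exact: sqr_ge0.
Qed.

Lemma frobenius_sqr_segment (R : realType) (m n : nat) (A B : 'M[R]_(m, n)) (t : R) :
  frobenius ((1 - t) *: A + t *: B) ^+ 2 =
  (1 - t) * frobenius A ^+ 2 + t * frobenius B ^+ 2
  - t * (1 - t) * frobenius (A - B) ^+ 2.
Proof.
rewrite !frobenius_sqr !mulr_sumr -big_split -sumrB; apply: eq_bigr => i _.
rewrite !mulr_sumr -big_split -sumrB; apply: eq_bigr => j _.
by rewrite !mxE /=; ring.
Qed.

Definition surrogate_quadratic (R : realType) (m n : nat)
    (Omega : {set 'I_m * 'I_n}) (Y : 'M[R]_(m, n)) (ell : R)
    (Xk X : 'M[R]_(m, n)) : R :=
  2^-1 * frobenius (proj_obs Omega (X - Y)) ^+ 2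
  + 2^-1 * frobenius (proj_unobs Omega (X - Xk)) ^+ 2
  + ell / 2 * frobenius (X - Xk) ^+ 2.

(** Each entry carries exactly one of the two projected squares, so the quadratic part has the same
    curvature [1 + ell] in every entry. *)
Lemma surrogate_quadratic_segment (R : realType) (m n : nat)
    (Omega : {set 'I_m * 'I_n}) (Y : 'M[R]_(m, n)) (ell : R)
    (Xk A B : 'M[R]_(m, n)) (t : R) :
  surrogate_quadratic Omega Y ell Xk ((1 - t) *: A + t *: B) =
  (1 - t) * surrogate_quadratic Omega Y ell Xk A
  + t * surrogate_quadratic Omega Y ell Xk B
  - (1 + ell) / 2 * (t * (1 - t)) * frobenius (A - B) ^+ 2.
Proof.
have qE X : surrogate_quadratic Omega Y ell Xk X = \sum_(i < m) \sum_(j < n)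
    ((if (i, j) \in Omega then (X i j - Y i j) ^+ 2 else (X i j - Xk i j) ^+ 2) / 2
     + ell / 2 * (X i j - Xk i j) ^+ 2).
  rewrite /surrogate_quadratic !frobenius_sqr !mulr_sumr -!big_split.
  apply: eq_bigr => i _; rewrite !mulr_sumr -!big_split; apply: eq_bigr => j _.
  by rewrite !mxE; case: ifP => _ /=; field.
rewrite !qE frobenius_sqr !mulr_sumr -big_split -sumrB; apply: eq_bigr => i _.
rewrite !mulr_sumr -big_split -sumrB; apply: eq_bigr => j _.
by rewrite !mxE; case: ifP => _ /=; field.
Qed.

Section SpectralPenalty.
Variables (R : realType) (P : R -> \bar R) (hP : penalty P) (m n : nat).
Implicit Types X A B : 'M[R]_(m, n).

Definition fine_spectral_penalty X : R :=
  \sum_(i < minn m n) fine (P (singular_value X i)).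

Lemma spectral_penaltyE X : spectral_penalty P X = (fine_spectral_penalty X)%:E.
Proof.
rewrite /spectral_penalty -sumEFin; apply: eq_bigr => i _.
by rewrite fineK // penalty_fin_num // singular_value_ge0.
Qed.

(** Removing [r / 2] times the squared Frobenius norm leaves the spectral sum of [curved_penalty],
    which has a subgradient at the intermediate point [C]. Testing it at [A] and [B] gives
    convexity; restoring the norm gives the last term. *)
Lemma spectral_penalty_segment (r : R) A B (t : R) :
  phi P = r%:E -> 0 <= t <= 1 ->
  fine_spectral_penalty ((1 - t) *: A + t *: B) <=
  (1 - t) * fine_spectral_penalty A + t * fine_spectral_penalty B
  - r / 2 * (t * (1 - t)) * frobenius (A - B) ^+ 2.
Proof.
move=> phiE /andP[t0 t1]; set C := _ + _.
have cE X : \sum_(i < minn m n) curved_penalty P r (singular_value X i) =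
    fine_spectral_penalty X - r / 2 * frobenius X ^+ 2.
  by rewrite sumrB -mulr_sumr sum_sqr_singular_value tr_gramE frobenius_sqr.
have g0 : curved_penalty' P r 0 = 0 by rewrite /curved_penalty' eqxx.
have [G hG] := spectral_subgradient C g0
  (curved_penalty'_le hP phiE) (curved_penalty_subgradient hP phiE).
have {}hG X : fine_spectral_penalty C - r / 2 * frobenius C ^+ 2 +
    \tr (G^T *m (X - C)) <= fine_spectral_penalty X - r / 2 * frobenius X ^+ 2.
  apply: le_trans (le_trans _ (hG X)) _; last by rewrite cE.
  by rewrite lerD2r cE.
have t1' : 0 <= 1 - t by rewrite subr_ge0.
have := lerD (ler_wpM2l t1' (hG A)) (ler_wpM2l t0 (hG B)).
(* The linear terms cancel because [C] is the weighted mean of [A] and [B]. *)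
have : (1 - t) * \tr (G^T *m (A - C)) + t * \tr (G^T *m (B - C)) = 0.
  rewrite -!mxtraceZ -mxtraceD !scalemxAr -mulmxDr !scalerBr addrACA -opprD.
  by rewrite -scalerDl subrK scale1r subrr mulmx0 mxtrace0.
rewrite [frobenius C ^+ 2]frobenius_sqr_segment.
move: (\tr _) (\tr _) (fine_spectral_penalty A) (fine_spectral_penalty B).
move: (fine_spectral_penalty C) (frobenius _ ^+ 2) (frobenius _ ^+ 2).
move: (frobenius _ ^+ 2) => *; lra.
Qed.

End SpectralPenalty.

(** * Descent *)

Lemma frobenius0 (R : realType) (m n : nat) : frobenius (0 : 'M[R]_(m, n)) = 0.
Proof.
rewrite /frobenius big1 ?sqrtr0 // => i _; rewrite big1 // => j _.
by rewrite mxE expr0n.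
Qed.

(** This is the limit as [t] tends to 0, needed after dividing a strong convexity inequality by
    [t]. *)
Lemma ge_of_ge_scaled (R : realFieldType) (a b : R) :
  (forall t : R, 0 < t -> t < 1 -> (1 - t) * a <= b) -> a <= b.
Proof.
move=> h; have [a0|a0] := leP a 0.
  by have := h 2^-1 ltac:(lra) ltac:(lra); lra.
apply/ler_addgt0Pr => e e0; pose t := Num.min 2^-1 (e / a).
have t0 : 0 < t by rewrite lt_min invr_gt0 ltr0n divr_gt0.
have t1 : t < 1 by rewrite gt_min invf_lt1 // ltr1n.
have ta : t * a <= e by rewrite -ler_pdivlMr // ge_min lexx orbT.
have := h t t0 t1; lra.
Qed.

Section Descent.
Variables (R : realType) (m n : nat) (Omega : {set 'I_m * 'I_n}).
Variables (Y : 'M[R]_(m, n)) (P : R -> \bar R) (hP : penalty P).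
Variables (ell : R) (hell : 0 <= ell).

Definition fine_objective (X : 'M[R]_(m, n)) : R :=
  2^-1 * frobenius (proj_obs Omega (X - Y)) ^+ 2 + fine_spectral_penalty P X.

Lemma objectiveE X : objective Omega Y P X = (fine_objective X)%:E.
Proof. by rewrite /objective spectral_penaltyE. Qed.

Lemma surrogateE Xk X : surrogate Omega Y P ell Xk X =
  (surrogate_quadratic Omega Y ell Xk X + fine_spectral_penalty P X)%:E.
Proof. by rewrite /surrogate spectral_penaltyE. Qed.

Lemma surrogate_strong_convexity (Xk X1 : 'M[R]_(m, n)) :
  argmin (surrogate Omega Y P ell Xk) X1 ->
  exists kappa : R, [/\ 0 <= kappa, nu_dagger P ell = kappa%:E &
    kappa / 2 * frobenius (X1 - Xk) ^+ 2 <=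
    (surrogate_quadratic Omega Y ell Xk Xk + fine_spectral_penalty P Xk)
    - (surrogate_quadratic Omega Y ell Xk X1 + fine_spectral_penalty P X1)].
Proof.
move=> X1min.
have X1le X : surrogate_quadratic Omega Y ell Xk X1 + fine_spectral_penalty P X1 <=
    surrogate_quadratic Omega Y ell Xk X + fine_spectral_penalty P X.
  by have := X1min X; rewrite !surrogateE lee_fin.
(* The infimum runs over a nonempty set: the points 1 and 2 give a quotient. *)
have phi_lty : (phi P < +oo)%E.
  apply: le_lt_trans (ltry ((penalty' P 1 - penalty' P 2) / (1 - 2))).
  by apply: ereal_inf_lbound; exists 1, 2; split=> //; rewrite lt_eqF ?ltr1n.
have nonpos : (nu P ell <= 0)%E -> nu_dagger P ell = 0%:E.
  by move=> nu0; apply/max_idPr.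
(* The nonpositive case includes [phi P = -oo]; there [kappa = 0] and minimality suffices. *)
have [nu0|nu0] := leP (nu P ell) 0%E.
  by exists 0; split; rewrite ?nonpos // !mul0r subr_ge0.
have -> : nu_dagger P ell = nu P ell by apply/max_idPl; exact: ltW.
move: nu0 phi_lty; rewrite /nu; case phiE: (phi P) => [r| |] //.
rewrite -!EFinD lte_fin => kappa0 _; exists (1 + r + ell); split=> //.
  exact: ltW.
(* The minimizer [X1] is compared with a point of the segment towards [Xk]. The curvatures [1 + ell]
   and [r] add up to [kappa], and a factor [t] cancels. *)
apply: ge_of_ge_scaled => t t0 t1.
have t01 : 0 <= t <= 1 by rewrite !ltW.
have := X1le ((1 - t) *: X1 + t *: Xk).
have := spectral_penalty_segment hP X1 Xk phiE t01.
rewrite surrogate_quadratic_segment.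
move: (surrogate_quadratic _ _ _ _ X1) (surrogate_quadratic _ _ _ _ Xk).
move: (fine_spectral_penalty P X1) (fine_spectral_penalty P Xk).
move: (fine_spectral_penalty P _) (frobenius _ ^+ 2) => S D S1 Sk q1 qk hS hF.
rewrite -(ler_pM2l t0).
have -> : t * ((1 - t) * ((1 + r + ell) / 2 * D)) =
  (1 + ell) / 2 * (t * (1 - t)) * D + r / 2 * (t * (1 - t)) * D by field.
lra.
Qed.

(** The surrogate equals the objective at [Xk] and exceeds it at [X1] by its two proximal terms.
    Adding these to the strong convexity gap gives [Delta]. *)
Lemma objective_descent (Xk X1 : 'M[R]_(m, n)) :
  argmin (surrogate Omega Y P ell Xk) X1 ->
  exists2 delta : R, 0 <= delta & Delta Omega P ell Xk X1 = delta%:E /\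
    delta <= fine_objective Xk - fine_objective X1.
Proof.
move=> /surrogate_strong_convexity[kappa [kappa0 nuE hk]].
exists ((kappa + ell) / 2 * frobenius (X1 - Xk) ^+ 2 +
  2^-1 * frobenius (proj_unobs Omega (X1 - Xk)) ^+ 2).
  by rewrite addr_ge0 // mulr_ge0 ?sqr_ge0 ?divr_ge0 ?addr_ge0.
split; first by rewrite /Delta nuE.
move: hk; rewrite /fine_objective /surrogate_quadratic (subrr Xk).
have -> : proj_unobs Omega (0 : 'M[R]_(m, n)) = 0.
  by apply/matrixP => i j; rewrite !mxE if_same subrr.
rewrite frobenius0 expr0n /= !mulr0 !addr0.
set fD := frobenius (X1 - Xk) ^+ 2; set fU := frobenius (proj_unobs _ _) ^+ 2.
set fOk := frobenius _ ^+ 2; set fO1 := frobenius _ ^+ 2.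
set sk := fine_spectral_penalty _ _; set s1 := fine_spectral_penalty _ _.
lra.
Qed.

End Descent.

Theorem proposition7 (R : realType) (m n : nat) (Omega : {set 'I_m * 'I_n})
    (Y : 'M[R]_(m, n)) (P : R -> \bar R) (hP : penalty P)
    (ell : R) (hell : 0 <= ell) (X : nat -> 'M[R]_(m, n))
    (hX : forall k : nat, (1 <= k)%N ->
       argmin (surrogate Omega Y P ell (X k)) (X k.+1)) :
  (forall k : nat, (1 <= k)%N ->
     (objective Omega Y P (X k.+1) <= objective Omega Y P (X k))%E) /\
  (forall fhat : R,
     objective Omega Y P (X k) @[k --> \oo] --> fhat%:E ->
     forall K : nat, (1 <= K)%N ->
       (\big[mine/+oo]_(1 <= k < K.+1) Delta Omega P ell (X k) (X k.+1)
        <= (K%:R^-1)%:E * (objective Omega Y P (X 1%N) - fhat%:E))%E).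
Proof.
pose f k := fine_objective Omega Y P (X k).
have fE k : objective Omega Y P (X k) = (f k)%:E by exact: objectiveE.
have step k : (1 <= k)%N -> exists2 delta : R, 0 <= delta &
    Delta Omega P ell (X k) (X k.+1) = delta%:E /\ delta <= f k - f k.+1.
  by move=> /hX; exact: objective_descent.
have fS k : (1 <= k)%N -> f k.+1 <= f k.
  by move=> /step[d d0 [_ hd]]; rewrite -subr_ge0 (le_trans d0).
split=> [k k1|fhat]; first by rewrite !fE lee_fin fS.
under eq_fun do rewrite fE; move=> /fine_cvg /= f_cvg K K1.
have f_ge k : (1 <= k)%N -> fhat <= f k.
  case: k => // k _.
  (* The shift discards [X 0], about which nothing is assumed. *)
  have cvgS : f i.+1 @[i --> \oo] --> fhat by rewrite (cvg_shiftS f).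
  rewrite -(cvg_lim _ cvgS) //.
  apply: (nonincreasing_cvgn_ge (u_ := fun i => f i.+1)).
    by apply/nonincreasing_seqP => i; exact: fS.
  by apply/cvg_ex; exists fhat.
rewrite fE -EFinB -EFinM.
suff [k /andP[k1 kK] hk] : exists2 k, (1 <= k < K.+1)%N &
    (Delta Omega P ell (X k) (X k.+1) <= (K%:R^-1 * (f 1%N - fhat))%:E)%E.
  apply: (@bigmin_inf_seq _ _ _ _ _ k xpredT) => //.
  by rewrite mem_index_iota k1.
(* If every [Delta] exceeded the bound, so would every decrease of [f]; but these telescope to
   [f 1 - f K.+1], which is at most [f 1 - fhat]. *)
apply: contrapT => none.
have : \sum_(1 <= k < K.+1) (K%:R^-1 * (f 1%N - fhat)) <
    \sum_(1 <= k < K.+1) (f k - f k.+1).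
  apply: ltr_sum_nat => // k kK; have [d _ [DeltaE hd]] := step k (andP kK).1.
  apply: lt_le_trans hd; rewrite ltNge; apply/negP => dle.
  by apply: none; exists k; rewrite // DeltaE lee_fin.
rewrite sumr_const_nat subn1 /=.
have -> a : (K%:R^-1 * a) *+ K = a :> R.
  by rewrite -[LHS]mulr_natl mulVKf // pnatr_eq0 -lt0n.
under eq_bigr do rewrite -opprB.
rewrite sumrN telescope_sumr // opprB ltrD2l ltrN2.
by rewrite ltNge f_ge.
Qed.
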